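(* Let $M$ be a closed oriented triangulated three-dimensional manifold with complex numbers $\zeta_i$, $\varkappa_i$ in general position assigned to the vertices $i$ of the triangulation. Then the sequence of vector spaces and linear mappings $$0\longrightarrow \mathfrak{so}(3,\mathbb C) \stackrel{\tilde g_1}{\longrightarrow} (dh)\oplus(dz) \stackrel{\tilde g_2}{\longrightarrow} (dL) \stackrel{\tilde g_3}{\longrightarrow} (d\Omega),$$ where $\tilde g_1=dG_1$, $\tilde g_2=dG_2$, $\tilde g_3=dG_3$, is a chain complex, i.e., $\tilde g_3\circ\tilde g_2=0$ and $\tilde g_2\circ\tilde g_1=0$.
   Context: Consider the complex Euclidean space of column vectors of height $3$ with the (bilinear) scalar product given by the matrix $\begin{pmatrix}0&0&-1\\0&2&0\\-1&0&0\end{pmatrix}$; $\mathrm{SO}(3,\mathbb C)$ is realized as the group of (determinant one) matrices preserving this scalar product, and $\mathfrak{so}(3,\mathbb C)$ is its Lie algebra. To each vertex $i$ two complex parameters $\zeta_i,\varkappa_i$ are assigned (in general position; in particular $\varkappa_i\ne0$ and $\zeta_i\ne\zeta_j$ for each edge $ij$), giving the initial isotropic vector $\vec e_i^{\ \mathrm{initial}}=(\varkappa_i\zeta_i^2,\varkappa_i\zeta_i,\varkappa_i)^{\mathrm T}$. Isotropic vectors in vertices are written as $\vec e_i=(h_iz_i^2,h_iz_i,h_i)^{\mathrm T}$ with complex $z_i,h_i$. The mapping $G_1$ sends $T\in\mathrm{SO}(3,\mathbb C)$ to the collection of vectors $\vec e_i=T\vec e_i^{\ \mathrm{initial}}$ for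 all $i$, expressed through their coordinates $(h_i,z_i)$. $G_2$ sends a collection $(\vec e_i)$ to the squared distances $L_{ij}$ between the ends of $\vec e_i$ and $\vec e_j$ for all edges $ij$ (vectors start at the origin), so that $L_{ij}=L_{ji}=-2\,\vec e_i\cdot\vec e_j$. $G_3$ sends a collection of squared edge lengths $L_{ij}$ to the collection of determinants, for all tetrahedra $ijkl$, $$\Omega_{ijkl}=\left|\begin{matrix}0&L_{ij}&L_{ik}&L_{il}\\L_{ji}&0&L_{jk}&L_{jl}\\L_{ki}&L_{kj}&0&L_{kl}\\L_{li}&L_{lj}&L_{lk}&0\end{matrix}\right|.$$ The differentials are taken at the initial point: $dG_1$ at the unit of the group, $dG_2$ at $h_i=\varkappa_i$, $z_i=\zeta_i$, and $dG_3$ at the corresponding values $L_{ij}=2\varkappa_i\varkappa_j(\zeta_i-\zeta_j)^2$. The spaces $(dh)$, $(dz)$, $(dL)$, $(d\Omega)$ are the $\mathbb C$-vector spaces of column vectors of the corresponding differentials $dh_i$, $dz_i$ (one for each vertex), $dL_{ij}$ (one for each edge), $d\Omega_{ijkl}$ (one for each tetrahedron). *)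

(* Defs.v *)
From HB Require Import structures.
From mathcomp Require Import all_boot all_order all_algebra ring.
From mathcomp Require Import all_classical all_reals all_analysis.

Set Implicit Arguments.
Unset Strict Implicit.
Unset Printing Implicit Defensive.

Import Order.TTheory GRing.Theory Num.Theory.
Import numFieldNormedType.Exports.

Local Open Scope classical_set_scope.
Local Open Scope ring_scope.

(** * Triangulated closed oriented 3-manifolds

    The vertices are numbered by ['I_n]; an abstract simplicial complex is the
    set [K] of its (nonempty) simplices, given by their vertex sets. *)

Section Triangulations.
Variable n : nat.
Implicit Type K : {set {set 'I_n}}.

Definition simplicial_complex K : Prop :=
  [/\ forall s, s \in K -> (0 < #|s|)%N,
      forall s t : {set 'I_n},
        s \in K -> t \subset s -> (0 < #|t|)%N -> t \in K
    & forall i : 'I_n, [set i]%SET \in K].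

(* The [k]-vertex simplices, each listed once, as the increasing sequence of
   its vertices. *)
Definition simplices (k : nat) K : {set k.-tuple 'I_n} :=
  [set t : k.-tuple 'I_n |
    sorted (fun i j : 'I_n => (i < j)%N) t && ([set x in t]%SET \in K)]%SET.

Definition edges K := simplices 2 K.
Definition tetrahedra K := simplices 4 K.

(* [or s] is the sign of the tetrahedron [s] relative to the increasing order
   of its vertices. Coherence means that the chain [\sum_s or s * s] is a cycle:
   [v] is the vertex of [v |: f] opposite to the triangle [f], and the exponent
   is the position of [v] among the vertices of [v |: f]. *)
Definition orientation K (or : {set 'I_n} -> int) : Prop :=
  (forall s, s \in K -> #|s| = 4%N -> or s = 1 \/ or s = - 1) /\
  (forall f : {set 'I_n}, f \in K -> #|f| = 3%N ->
     \sum_(v | (v \notin f) && ((v |: f)%SET \in K))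
        (-1) ^+ #|[set w in f | (w < v)%N]%SET| * or (v |: f)%SET = 0).

Definition realization (R : realType) K : set 'rV[R]_n :=
  [set x | [/\ forall i, 0 <= x 0 i, \sum_i x 0 i = 1
             & [set i | x 0 i != 0]%SET \in K]].

End Triangulations.

(* [f] restricts to a homeomorphism from the subspace [A] onto the subspace
   [B]. *)
Definition homeomorphism_on (X Y : topologicalType) (f : X -> Y)
    (A : set X) (B : set Y) : Prop :=
  [/\ set_bij A B f, {within A, continuous f}
    & forall U, open U -> exists2 W, open W & f @` (A `&` U) = B `&` W].

(* Second countability follows from compactness. *)
Definition closed_manifold3 (R : realType) (M : topologicalType) : Prop :=
  [/\ hausdorff_space M, compact [set: M]
    & forall x : M, exists (U : set M) (B : set 'rV[R]_3) (f : M -> 'rV[R]_3),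
        [/\ open U, U x, open B & homeomorphism_on f U B]].

Definition triangulation (R : realType) (M : topologicalType) (n : nat)
    (K : {set {set 'I_n}}) (phi : M -> 'rV[R]_n) : Prop :=
  simplicial_complex K /\ homeomorphism_on phi [set: M] (@realization n R K).

(* [0 -> U -> V -> W -> X] is a chain complex; the condition at [U] is void. *)
Definition chain_complex (F : pzRingType) (U V W X : lmodType F)
    (f : {linear U -> V}) (g : {linear V -> W}) (h : {linear W -> X}) : Prop :=
  (forall v, h (g v) = 0) /\ (forall u, g (f u) = 0).

(** * The complex Euclidean space and its isotropic vectors

    Everything makes sense over any [numFieldType]; the scalars of interest are
    the complex numbers [R[i]]. *)

Section Euclidean.
Variable C : numFieldType.

Definition gram : 'M[C]_3 :=
  \matrix_(i < 3, j < 3)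
    nth 0 (nth [::] [:: [:: 0; 0; -1]; [:: 0; 2; 0]; [:: -1; 0; 0]] i) j.

Definition dot (u v : 'cV[C]_3) : C := (u^T *m gram *m v) 0 0.

Definition isovec (h z : C) : 'cV[C]_3 :=
  \col_(a < 3) nth 0 [:: h * z ^+ 2; h * z; h] a.

Definition hcoord (v : 'cV[C]_3) : C := v 2 0.
Definition zcoord (v : 'cV[C]_3) : C := v 1 0 / v 2 0.

Definition sqdist (u v : 'cV[C]_3) : C := dot (u - v) (u - v).

Definition SO3 : set 'M[C]_3 :=
  [set T | T^T *m gram *m T = gram /\ \det T = 1].

Definition so3 : {vspace 'M[C]_3} :=
  lker (linfun (fun X : 'M[C]_3 => X^T *m gram + gram *m X)).

Lemma dotE (u v : 'cV[C]_3) :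
  dot u v = 2 * u 1 0 * v 1 0 - u 0 0 * v 2 0 - u 2 0 * v 0 0.
Proof.
have e0 : lift ord0 (lift ord0 ord0) = 2 :> 'I_3 by apply/val_inj.
have e1 : lift ord0 ord0 = 1 :> 'I_3 by apply/val_inj.
have e2 : ord0 = 0 :> 'I_3 by apply/val_inj.
rewrite /dot !mxE !big_ord_recl big_ord0 !mxE !big_ord_recl !big_ord0 !mxE /=.
rewrite e0 e1 e2. ring.
Qed.

Lemma sqdist_isovec (h z h' z' : C) :
  sqdist (isovec h z) (isovec h' z') = 2 * h * h' * (z - z') ^+ 2.
Proof. by rewrite /sqdist dotE !mxE /=; ring. Qed.

Lemma sqdist_isovecN2dot (h z h' z' : C) :
  sqdist (isovec h z) (isovec h' z') = -2 * dot (isovec h z) (isovec h' z').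
Proof. by rewrite /sqdist !dotE !mxE /=; ring. Qed.

Lemma isovec_coord (v : 'cV[C]_3) : dot v v = 0 -> v 2 0 != 0 ->
  v = isovec (hcoord v) (zcoord v).
Proof.
rewrite dotE /hcoord /zcoord => v0 v2; apply/colP => i; rewrite !mxE.
case: i => -[|[|[|//]]] lti /=.
- have -> : Ordinal lti = 0 by apply/val_inj.
  have {}v0 : v 1 0 * v 1 0 = v 0 0 * v 2 0.
    apply: (mulfI (_ : (2 : C) != 0)); first by rewrite pnatr_eq0.
    by apply/eqP; rewrite -subr_eq0 -[X in _ == X]v0; apply/eqP; ring.
  by rewrite exprMn exprVn !expr2 v0; field.
- have -> : Ordinal lti = 1 by apply/val_inj.
  by rewrite mulrC mulfVK.
- by congr (v _ 0); apply/val_inj.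
Qed.

Lemma mem_so3 (X : 'M[C]_3) :
  (X \in so3) = (X^T *m gram + gram *m X == 0).
Proof.
pose f := fun X : 'M[C]_3 => X^T *m gram + gram *m X.
have fl : linear f.
  move=> a u v; rewrite /f linearP /= mulmxDl mulmxDr scalerDr -!scalemxAl -scalemxAr.
  by rewrite addrACA.
pose g : {linear 'M[C]_3 -> 'M[C]_3} := HB.pack f (GRing.isLinear.Build _ _ _ _ f fl).
by rewrite memv_ker -[linfun _]/(linfun g) lfunE.
Qed.

Lemma mulmx_gramE (A B : 'M[C]_3) i j :
  (A^T *m gram *m B) i j =
  2 * (A 1 i * B 1 j) - A 0 i * B 2 j - A 2 i * B 0 j.
Proof.
have e0 : lift ord0 (lift ord0 ord0) = 2 :> 'I_3 by apply/val_inj.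
have e1 : lift ord0 ord0 = 1 :> 'I_3 by apply/val_inj.
have e2 : ord0 = 0 :> 'I_3 by apply/val_inj.
rewrite !mxE !big_ord_recl big_ord0 !mxE !big_ord_recl !big_ord0 !mxE /=.
rewrite e0 e1 e2; ring.
Qed.

Lemma det3E (A : 'M[C]_3) : \det A =
  A 0 0 * (A 1 1 * A 2 2 - A 1 2 * A 2 1)
  - A 0 1 * (A 1 0 * A 2 2 - A 1 2 * A 2 0)
  + A 0 2 * (A 1 0 * A 2 1 - A 1 1 * A 2 0).
Proof.
pose a m n : C := A (inZp m) (inZp n).
have Ea i j : A i j = a i j by rewrite /a !valZpK.
rewrite (expand_det_row _ ord0) !big_ord_recl big_ord0 /cofactor.
rewrite !(expand_det_row _ ord0) !big_ord_recl !big_ord0 /cofactor !det_mx11 !mxE.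
rewrite !Ea /= /bump /= /bump /=; ring.
Qed.

(* [so3] is the tangent space to [SO3] at the unit. *)
Lemma so3_tangent (X : 'M[C]_3) :
  X \in so3 <-> exists gamma : C -> 'M[C]_3,
    [/\ gamma 0 = 1%:M, \forall t \near (0 : C), SO3 (gamma t)
      & forall i j, is_derive (0 : C) 1 (fun t => gamma t i j) (X i j)].
Proof.
rewrite mem_so3; split; last first.
  move=> [g [g0 gSO dg]]; apply/eqP/matrixP => i j.
  have -> : X^T *m gram + gram *m X =
      X^T *m gram *m 1%:M + 1%:M^T *m gram *m X.
    by rewrite mulmx1 trmx1 mul1mx.
  rewrite [LHS]mxE !mulmx_gramE [RHS]mxE -g0.
  pose G k l t := g t k l.
  have dG k l : is_derive (0 : C) 1 (G k l) (X k l) by exact: dg.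
  pose f := 2 \*: (G 1 i * G 1 j) - G 0 i * G 2 j - G 2 i * G 0 j.
  have df : is_derive (0 : C) 1 f (2 * (X 1 i * g 0 1 j) - X 0 i * g 0 2 j
    - X 2 i * g 0 0 j + (2 * (g 0 1 i * X 1 j) - g 0 0 i * X 2 j
    - g 0 2 i * X 0 j)).
    apply: is_derive_eq; rewrite /G /GRing.scale /=; ring.
  rewrite -(@derive_val _ _ _ _ _ _ _ df).
  rewrite (@near_eq_derive _ _ _ _ (cst (gram i j))).
    exact: derive_val.
  near=> t.
  have [+ _] : SO3 (g t) by near: t.
  by move=> /matrixP/(_ i j); rewrite mulmx_gramE.
move=> /eqP/matrixP X0.
have E i j := X0 i j.
have {}E i j : 2 * (X 1 i * (1 == j)%:R) - X 0 i * (2 == j)%:R - X 2 i * (0 == j)%:R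
   + (2 * ((1 == i)%:R * X 1 j) - (0 == i)%:R * X 2 j - (2 == i)%:R * X 0 j) = 0 :> C.
  have := X0 i j.
  have -> : X^T *m gram + gram *m X =
      X^T *m gram *m 1%:M + 1%:M^T *m gram *m X.
    by rewrite mulmx1 trmx1 mul1mx.
  by rewrite mxE !mulmx_gramE !mxE => <-; rewrite ?mulr1n.
have mul2I (x y : C) : 2 * x = 2 * y -> x = y by apply/mulfI; rewrite pnatr_eq0.
have x20 : X 2 0 = 0 by apply: mul2I; move: (E 0 0) => /= h; rewrite mulr0 -[RHS]oppr0 -h; ring.
have x02 : X 0 2 = 0 by apply: mul2I; move: (E 2 2) => /= h; rewrite mulr0 -[RHS]oppr0 -h; ring.
have x11 : X 1 1 = 0 by apply/mul2I/mul2I; move: (E 1 1) => /= h; rewrite !mulr0 -h; ring.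
have x22 : X 2 2 = - X 0 0.
  by apply/eqP; rewrite -addr_eq0; apply/eqP; move: (E 0 2) => /= h; rewrite -[RHS]oppr0 -h; ring.
have x01 : X 0 1 = 2 * X 1 2.
  by apply/eqP; rewrite -subr_eq0; apply/eqP; move: (E 1 2) => /= h; rewrite -[RHS]oppr0 -h; ring.
have x21 : X 2 1 = 2 * X 1 0.
  by apply/eqP; rewrite -subr_eq0; apply/eqP; move: (E 1 0) => /= h; rewrite -[RHS]oppr0 -h; ring.
pose c := X 0 0 ^+ 2 + 4 * X 1 2 * X 1 0.
pose D t : C := 1 - t ^+ 2 * (c / 4).
exists (fun t => 1%:M + (t / D t) *: X + (t ^+ 2 / (2 * D t)) *: (X *m X)).
have XX i j : (X *m X) i j = X i 0 * X 0 j + X i 1 * X 1 j + X i 2 * X 2 j.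
  have e0 : lift ord0 (lift ord0 ord0) = 2 :> 'I_3 by apply/val_inj.
  have e1 : lift ord0 ord0 = 1 :> 'I_3 by apply/val_inj.
  have e2 : ord0 = 0 :> 'I_3 by apply/val_inj.
  by rewrite !mxE !big_ord_recl big_ord0 e0 e1 e2 addr0 addrA.
have D0 : D 0 = 1 by rewrite /D expr0n /= mul0r subr0.
have Dc : D @ nbhs (0 : C) --> D 0.
  have c1 : (fun _ : C => 1 : C) @ nbhs (0 : C) --> (1 : C) by exact: cvg_cst.
  have c2 : (fun _ : C => c / 4 : C) @ nbhs (0 : C) --> (c / 4 : C) by exact: cvg_cst.
  have c3 : id @ nbhs (0 : C) --> (0 : C) by exact: cvg_id.
  have -> : D = (fun t => 1 - t * t * (c / 4)) by apply/funext => t; rewrite /D expr2.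
  exact: (cvgB c1 (cvgM (cvgM c3 c3) c2)).
have ND : \forall t \near (0 : C), D t != 0.
  move/cvgrPdist_lt : Dc => /(_ 1 ltr01).
  rewrite D0 => Dn; near=> t; apply/negP => /eqP Dt0.
  have : `|1 - D t| < 1 by near: t.
  by rewrite Dt0 subr0 normr1 ltxx.
split.
- by rewrite expr0n /= !mul0r !scale0r !addr0.
- near=> t.
  have Dt : D t != 0.
    by near: t; exact: ND.
  pose a := t / D t; pose b := t ^+ 2 / (2 * D t).
  have four : (4 : C) != 0 by rewrite pnatr_eq0.
  have ab : 2 * b - a ^+ 2 + b ^+ 2 * c = 0.
    rewrite /a /b /D; field.
    apply: contra Dt; rewrite subr_eq0 /D => /eqP h4.
    by rewrite mulrA -h4 mulfV ?subrr.
  have ord3 (i : 'I_3) : [\/ i = 0, i = 1 | i = 2].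
    by case: i => -[|[|[|//]]] lti; [apply: Or31|apply: Or32|apply: Or33]; apply/val_inj.
  rewrite -/a -/b; have Te k l : (1%:M + a *: X + b *: (X *m X)) k l = (k == l)%:R + a * X k l + b * (X *m X) k l.
      by rewrite 5!mxE.
  split.
    apply/matrixP => i j.
    rewrite mulmx_gramE -[RHS]addr0 -[X in _ = _ + X](mul0r ((gram *m (X *m X)) i j)) -ab.
    have -> : gram *m (X *m X) = 1%:M^T *m gram *m (X *m X).
      by rewrite trmx1 mul1mx.
    have -> : gram i j = (1%:M^T *m gram *m 1%:M) i j by rewrite trmx1 mul1mx mulmx1.
    rewrite !mulmx_gramE.
    rewrite !Te !XX.
    have oneE k l : (1%:M : 'M[C]_3) k l = (k == l)%:R by rewrite mxE.
    rewrite !oneE.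
    case: (ord3 i) => ->; case: (ord3 j) => -> /=; rewrite /c ?x20 ?x02 ?x11 ?x22 ?x01 ?x21; ring.
  have -> : \det (1%:M + a *: X + b *: (X *m X)) = 1 + (2 * b - a ^+ 2 + b ^+ 2 * c) * c.
    rewrite det3E !Te !XX /= /c x20 x02 x11 x22 x01 x21 mulr0n mulr1n; ring.
  by rewrite ab mul0r addr0.
move=> i j.
pose h t : C := (1%:M : 'M[C]_3) i j + t * (X i j / D t + t * ((X *m X) i j / (2 * D t))).
have -> : (fun t => (1%:M + (t / D t) *: X + (t ^+ 2 / (2 * D t)) *: (X *m X)) i j) = h.
  have Te (u v : C) Y : (1%:M + u *: X + v *: Y) i j = (1%:M : 'M[C]_3) i j + u * X i j + v * Y i j.
    by rewrite !mxE.
  by apply/funext => t; rewrite Te /h expr2; ring.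
have cv : (fun t : C => t^-1 *: ((h \o shift 0) (t *: 1) - h 0)) @ 0^' --> X i j.
  have {}Dc : D @ (0 : C)^' --> D 0 by exact: cvg_within_filter.
  have cc (x : C) : (fun _ : C => x) @ (0 : C)^' --> x by exact: cvg_cst.
  have c3 : id @ (0 : C)^' --> (0 : C) by exact: cvg_within.
  have D2 : 2 * D 0 != 0 by rewrite D0 mulr1 pnatr_eq0.
  have D1 : D 0 != 0 by rewrite D0 oner_eq0.
  have -> : X i j = X i j / D 0 + 0 * ((X *m X) i j / (2 * D 0)).
    by rewrite D0 divr1 mul0r addr0.
  apply: (@cvg_trans _ ((fun t => X i j / D t + t * ((X *m X) i j / (2 * D t))) @ 0^')).
    apply: near_eq_cvg; near=> t.
    have t0 : t != 0 by near: t; exact: nbhs_dnbhs_neq.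
    have t1 : (t *: (1 : C)) + 0 = t by rewrite addr0 /GRing.scale /= mulr1.
    rewrite /= t1 /h mul0r addr0 addrAC subrr add0r /GRing.scale /=.
    by rewrite mulKf.
  exact: (cvgD (cvgM (cc _) (cvgV D1 Dc)) (cvgM c3 (cvgM (cc _) (cvgV D2 (cvgM (cc _) Dc))))).
split; first by apply/cvg_ex; exists (X i j).
exact/cvg_lim.
Unshelve. all: by end_near. Qed.

(** * The maps [G1], [G2], [G3] and their differentials *)

Section Maps.
Variable n : nat.

(* Pairs (dh, dz). *)
Definition dhdz : normedModType C := ('cV[C]_n * 'cV[C]_n)%type.

(* Since the coordinates of [T *m e_i] are rational in the entries of [T], the
   map is written on all matrices; its differential along [SO3] at the unit is
   the restriction to [so3] of the differential of this extension. *)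
Definition G1 (kappa zeta : 'cV[C]_n) (T : 'M[C]_3) : dhdz :=
  (\col_i hcoord (T *m isovec (kappa i 0) (zeta i 0)),
   \col_i zcoord (T *m isovec (kappa i 0) (zeta i 0))).

Lemma G1_1 (kappa zeta : 'cV[C]_n) : (forall i, kappa i 0 != 0) ->
  G1 kappa zeta 1%:M = (kappa, zeta).
Proof.
move=> k0; congr pair; apply/colP => i; rewrite !mxE /= mul1mx /hcoord /zcoord !mxE //=.
by rewrite mulrAC mulfV ?mul1r.
Qed.

Variable K : {set {set 'I_n}}.

Definition dLs : normedModType C := 'cV[C]_#|edges K|.
Definition dOmegas : normedModType C := 'cV[C]_#|tetrahedra K|.

Definition G2 (p : dhdz) : dLs :=
  \col_e let i := tnth (enum_val e) 0 in let j := tnth (enum_val e) 1 in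
    sqdist (isovec (p.1 i 0) (p.2 i 0)) (isovec (p.1 j 0) (p.2 j 0)).

(* [L_ij], symmetric in [i] and [j]: the sum has exactly one term when [ij] is
   an edge. *)
Definition Lval (L : dLs) (i j : 'I_n) : C :=
  \sum_(e < #|edges K| | [set x in enum_val e]%SET == [set i; j]%SET) L e 0.

Lemma LvalE (L : dLs) (e : 'I_#|edges K|) :
  Lval L (tnth (enum_val e) 0) (tnth (enum_val e) 1) = L e 0.
Proof.
have es (f : 'I_#|edges K|) : [set x in enum_val f]%SET = [set tnth (enum_val f) 0; tnth (enum_val f) 1]%SET.
  case: (enum_val f) => -[|x [|y []]] // i; apply/setP=> z; rewrite !inE.
  by rewrite /tnth /=.
rewrite /Lval (big_pred1 e) // => f; rewrite -es; apply/eqP/eqP => [/setP ef|-> //].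
apply: enum_val_inj; apply/val_inj.
have := enum_valP f; have := enum_valP e; rewrite !inE => /andP[se _] /andP[sf _].
apply: (irr_sorted_eq (leT := fun i j : 'I_n => (i < j)%N)) => //.
- by move=> x y z; apply: ltn_trans.
- by move=> x; rewrite ltnn.
- by move=> x; have := ef x; rewrite !inE.
Qed.

Definition G3 (L : dLs) : dOmegas :=
  \col_t \det (\matrix_(a < 4, b < 4)
     (if a == b then 0 else Lval L (tnth (enum_val t) a) (tnth (enum_val t) b))).

Variables kappa zeta : 'cV[C]_n.

Definition L0 : dLs :=
  \col_e let i := tnth (enum_val e) 0 in let j := tnth (enum_val e) 1 in
    2 * kappa i 0 * kappa j 0 * (zeta i 0 - zeta j 0) ^+ 2.

Lemma G2_initial :
  G2 (kappa, zeta) = L0.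
Proof. by apply/colP => e; rewrite !mxE /= sqdist_isovec. Qed.

Definition g1 : {linear subvs_of so3 -> dhdz} :=
  'd (G1 kappa zeta) (1%:M : 'M[C]_3) \o vsval.
Definition g2 : {linear dhdz -> dLs} := 'd G2 ((kappa, zeta) : dhdz).
Definition g3 : {linear dLs -> dOmegas} := 'd G3 L0.

(* ['d f x] is a meaningless default when [f] is not differentiable at [x], so
   [g1], [g2] and [g3] are the intended maps only together with this. *)
Definition differentials_exist : Prop :=
  [/\ differentiable (G1 kappa zeta) (1%:M : 'M[C]_3),
      differentiable G2 ((kappa, zeta) : dhdz)
    & differentiable G3 L0].

End Maps.
End Euclidean.

(* Main.v *)
Require Import Defs.
From HB Require Import structures.
From mathcomp Require Import all_boot all_order all_algebra ring.
From mathcomp Require Import complex.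
From mathcomp Require Import all_classical all_reals all_analysis.

(** The two compositions vanish because the nonlinear maps themselves compose
    to constants along the relevant directions; the chain rule then gives the
    statement about differentials.

    - A rotation preserves scalar products, so the squared distances between
      the vectors [T *m e_i] do not depend on [T] in [SO3] ([G2_G1_SO3]).
      Every [X] in [so3] is the velocity at the unit of a path in [SO3]
      ([so3_tangent]), and the composite of [G2], [G1] and this path is
      locally constant ([g2_g1_eq0]).
    - Vectors of a 3-dimensional space have vanishing 4 x 4 Gram determinants,
      and for isotropic vectors [L_ij] is -2 times the scalar product.  All
      edges of a tetrahedron of a simplicial complex belong to the complex, so
      these are the lengths that enter [G3]; hence [G3 \o G2] is identically
      zero ([G3_G2]), and so is its differential ([g3_g2_eq0]).

    The maps are differentiable since their entries are polynomials or, for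
    the coordinate [z] of [T *m e_i], a quotient whose denominator at [T = 1]
    is [kappa i]; differentiability is checked entry by entry
    ([differentiable_mx], [differentiable_det]). *)

Set Implicit Arguments.
Unset Strict Implicit.
Unset Printing Implicit Defensive.

Import Order.TTheory GRing.Theory Num.Theory.
Import numFieldNormedType.Exports.

Local Open Scope classical_set_scope.
Local Open Scope ring_scope.
Local Open Scope complex_scope.

(** * Differentiability of matrix-valued maps *)

Section MatrixDifferentiability.
Context {C : numFieldType} {V : normedModType C}.
Implicit Type x : V.

Lemma eq_differentiable (W : normedModType C) (f g : V -> W) x :
  f =1 g -> differentiable g x -> differentiable f x.
Proof. by move=> /funext ->. Qed.

Lemma differentiable_bigsum (W : normedModType C) (I : Type) (r : seq I)
    (P : pred I) (f : I -> V -> W) x :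
  (forall i, P i -> differentiable (f i) x) ->
  differentiable (fun y => \sum_(i <- r | P i) f i y) x.
Proof.
move=> df; elim: r => [|i r IH].
  rewrite (_ : (fun _ => _) = cst 0); first exact: differentiable_cst.
  by apply/funext => y; rewrite big_nil.
rewrite (_ : (fun _ => _) = fun y =>
    if P i then f i y + \sum_(j <- r | P j) f j y
    else \sum_(j <- r | P j) f j y); last first.
  by apply/funext => y; rewrite big_cons.
by case Pi: (P i) => //; exact: (differentiableD (df i Pi) IH).
Qed.

Lemma differentiable_bigprod (I : Type) (r : seq I) (P : pred I)
    (f : I -> V -> C) x :
  (forall i, P i -> differentiable (f i) x) ->
  differentiable (fun y => \prod_(i <- r | P i) f i y) x.
Proof.
move=> df; elim: r => [|i r IH].
  rewrite (_ : (fun _ => _) = cst 1); first exact: differentiable_cst.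
  by apply/funext => y; rewrite big_nil.
rewrite (_ : (fun _ => _) = fun y =>
    if P i then f i y * \prod_(j <- r | P j) f j y
    else \prod_(j <- r | P j) f j y); last first.
  by apply/funext => y; rewrite big_cons.
by case Pi: (P i) => //; exact: (differentiableM (df i Pi) IH).
Qed.

(** A matrix is a combination of the constant matrices [delta_mx i j] with its
    entries as coefficients. *)
Lemma differentiable_mx m n (f : V -> 'M[C]_(m, n)) x :
  (forall i j, differentiable (fun y => f y i j) x) -> differentiable f x.
Proof.
move=> df; apply: eq_differentiable => [y|]; first exact: matrix_sum_delta.
by do 2![apply: differentiable_bigsum => ? _]; exact: differentiableZl.
Qed.

Lemma differentiable_entry m n (f : V -> 'M[C]_(m, n)) x i j :
  differentiable f x -> differentiable (fun y => f y i j) x.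
Proof.
move=> df; apply: (differentiable_comp (g := fun A : 'M[C]_(m, n) => A i j)) => //.
exact: differentiable_coord.
Qed.

(** Taking an entry is linear and continuous, hence is its own differential. *)
Lemma diff_entry m n (f : V -> 'M[C]_(m, n)) x v i j :
  differentiable f x -> 'd f x v i j = 'd (fun y => f y i j) x v.
Proof.
move=> df; pose entry (A : 'M[C]_(m, n)) := A i j.
have entry_linear : linear entry by move=> a A B; rewrite /entry !mxE.
pose p : {linear 'M[C]_(m, n) -> C} :=
  HB.pack entry (GRing.isLinear.Build _ _ _ _ entry entry_linear).
have cp : continuous p by exact: coord_continuous.
rewrite -[fun y => _]/(p \o f) (diff_comp df); last exact: linear_differentiable.
by rewrite /= (diff_lin _ cp).
Qed.

(** The Leibniz formula is a polynomial in the entries. *)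
Lemma differentiable_det n (f : V -> 'M[C]_n) x :
  (forall i j, differentiable (fun y => f y i j) x) ->
  differentiable (fun y => \det (f y)) x.
Proof.
move=> df; apply: differentiable_bigsum => s _.
apply: differentiableM; first exact: differentiable_cst.
exact: differentiable_bigprod.
Qed.

End MatrixDifferentiability.

(** A path of matrices given by its entrywise derivatives, as in
    [so3_tangent], has a differential to which the chain rule applies. *)
Lemma differentiable_path (C : numFieldType) m n (g : C -> 'M[C]_(m, n))
    (t : C) (X : 'M[C]_(m, n)) :
  (forall i j, is_derive t 1 (fun s => g s i j) (X i j)) ->
  differentiable g t /\ 'd g t 1 = X.
Proof.
move=> dg.
have dge i j : differentiable (fun s => g s i j) t.
  by apply/derivable1_diffP; exact: (@ex_derive _ _ _ _ _ _ _ (dg i j)).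
have dG : differentiable g t by exact: differentiable_mx.
split=> //; apply/matrixP => i j; rewrite diff_entry // -deriveE //.
exact: (@derive_val _ _ _ _ _ _ _ (dg i j)).
Qed.

Lemma differentiable_mulmxr (C : numFieldType) m n (e : 'cV[C]_n)
    (T : 'M[C]_(m, n)) i :
  differentiable (fun T : 'M[C]_(m, n) => (T *m e) i 0) T.
Proof.
apply: eq_differentiable => [A|]; first by rewrite mxE.
apply: differentiable_bigsum => a _.
by apply: differentiableM; [exact: differentiable_coord|exact: differentiable_cst].
Qed.

(** * Scalar products in the complex Euclidean space *)

Section ScalarProducts.
Variable C : numFieldType.
Implicit Types u v : 'cV[C]_3.

Lemma dot_SO3 (T : 'M[C]_3) u v : SO3 T -> dot (T *m u) (T *m v) = dot u v.
Proof. by case=> TgT _; rewrite /dot trmx_mul -[in RHS]TgT !mulmxA. Qed.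

Lemma sqdist_SO3 (T : 'M[C]_3) u v :
  SO3 T -> sqdist (T *m u) (T *m v) = sqdist u v.
Proof. by move=> ST; rewrite /sqdist -mulmxBr dot_SO3. Qed.

Lemma sqdistC u v : sqdist u v = sqdist v u.
Proof. by rewrite /sqdist !dotE !mxE; ring. Qed.

Lemma dot_isovec (h z : C) : dot (isovec h z) (isovec h z) = 0.
Proof. by rewrite dotE !mxE /=; ring. Qed.

(** The Gram matrix factors through the 3-dimensional space in which the four
    vectors live, so its rank is at most 3. *)
Lemma det_dot_eq0 (c : C) (u : 'I_4 -> 'cV[C]_3) :
  \det (\matrix_(a < 4, b < 4) (c * dot (u a) (u b))) = 0.
Proof.
pose U := \matrix_(i < 3, a < 4) u a i 0.
have -> : (\matrix_(a < 4, b < 4) (c * dot (u a) (u b))) =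
    (c *: (U^T *m gram C)) *m U.
  apply/matrixP => a b.
  rewrite -scalemxAl [LHS]mxE [RHS]mxE /dot; congr (_ * _); rewrite 2!mxE.
  by apply: eq_bigr => k _; rewrite !mxE; under eq_bigr do rewrite mxE;
    under [in RHS]eq_bigr do rewrite 2!mxE.
apply/eqP; apply: contraTT isT => /=.
rewrite -unitfE -unitmxE -row_free_unit /row_free => /eqP rank4.
have := leq_trans (mxrankM_maxr (c *: (U^T *m gram C)) U) (rank_leq_row U).
by rewrite rank4.
Qed.

End ScalarProducts.

(** * The chain complex *)

Section ChainComplex.
Variables (C : numFieldType) (n : nat) (K : {set {set 'I_n}}).
Implicit Types (kappa zeta : 'cV[C]_n) (p : dhdz C n) (L : dLs C K).

Lemma differentiable_G1 kappa zeta : (forall i, kappa i 0 != 0) ->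
  differentiable (G1 kappa zeta) (1%:M : 'M[C]_3).
Proof.
move=> k0; rewrite /G1; apply: differentiable_pair;
    apply: differentiable_mx => i j.
  apply: eq_differentiable => [T|]; first by rewrite mxE.
  exact: differentiable_mulmxr.
apply: eq_differentiable => [T|]; first by rewrite mxE /zcoord.
apply: differentiableM; first exact: differentiable_mulmxr.
apply: differentiableV; first exact: differentiable_mulmxr.
by rewrite mul1mx mxE /=.
Qed.

Lemma differentiable_G2 p : differentiable (G2 K : dhdz C n -> dLs C K) p.
Proof.
have dh i : differentiable (fun q : dhdz C n => q.1 i 0) p.
  apply: differentiable_entry; apply: linear_differentiable => q.
  exact: cvg_fst.
have dz i : differentiable (fun q : dhdz C n => q.2 i 0) p.
  apply: differentiable_entry; apply: linear_differentiable => q.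
  exact: cvg_snd.
apply: differentiable_mx => e k.
apply: eq_differentiable => [q|].
  by rewrite mxE /= sqdist_isovec expr2.
apply: differentiableM; last first.
  by apply: differentiableM; apply: differentiableB; exact: dz.
apply: differentiableM; last exact: dh.
by apply: differentiableM; [exact: differentiable_cst|exact: dh].
Qed.

Lemma differentiable_G3 L : differentiable (@G3 C n K : dLs C K -> dOmegas C K) L.
Proof.
apply: differentiable_mx => s k.
apply: eq_differentiable => [y|]; first by rewrite mxE.
apply: differentiable_det => a b.
apply: eq_differentiable => [y|]; first by rewrite mxE.
case: eqP => _; first exact: differentiable_cst.
by apply: differentiable_bigsum => e _; exact: differentiable_coord.
Qed.

(** The coordinates [(h, z)] recover an isotropic vector as long as its last
    entry is nonzero, so [G2] sees the vectors [T *m e_i] themselves. *)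
Lemma G2_G1_SO3 kappa zeta (T : 'M[C]_3) : SO3 T ->
  (forall i, (T *m isovec (kappa i 0) (zeta i 0)) 2 0 != 0) ->
  G2 K (G1 kappa zeta T) = G2 K (kappa, zeta).
Proof.
move=> ST nz; apply/colP => e; rewrite !mxE /= !mxE.
by rewrite -!isovec_coord ?dot_SO3 ?dot_isovec ?sqdist_SO3.
Qed.

Lemma g2_g1_eq0 kappa zeta (k0 : forall i, kappa i 0 != 0)
    (X : subvs_of (so3 C)) :
  g2 K kappa zeta (g1 kappa zeta X) = 0.
Proof.
have /so3_tangent[gamma [gamma0 gammaSO dgamma]] := subvsP X.
have [dg gX] := differentiable_path dgamma.
have dG1 := differentiable_G1 zeta k0; have G11 := G1_1 zeta k0.
rewrite /g1 /g2 /= -gX -G11 -gamma0; rewrite -gamma0 in dG1 G11.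
have dG1g : differentiable (G1 kappa zeta \o gamma) 0.
  exact: differentiable_comp.
have dG2 := differentiable_G2 ((G1 kappa zeta \o gamma) 0).
have := deriveE (1 : C) (differentiable_comp dG1g dG2).
rewrite diff_comp // /= (diff_comp dg dG1) /= => <-.
rewrite (@near_eq_derive _ _ _ _ (cst (G2 K (kappa, zeta)))) ?derive_cst //.
near=> t; apply: G2_G1_SO3; first by near: t.
(* The last entries are [kappa i] at [t = 0] and vary continuously. *)
near: t; apply: filter_forall => i.
pose e := isovec (kappa i 0) (zeta i 0).
have : {for 0, continuous (fun t => (gamma t *m e) 2 0)}.
  apply: differentiable_continuous.
  apply: (differentiable_comp (g := fun T : 'M[C]_3 => (T *m e) 2 0)) => //.
  exact: differentiable_mulmxr.
by move/cvgr_neq0; apply; rewrite gamma0 mul1mx mxE /=.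
Unshelve. all: by end_near. Qed.

Lemma Lval_G2 p (i j : 'I_n) : i != j -> [set i; j]%SET \in K ->
  Lval (G2 K p) i j =
  sqdist (isovec (p.1 i 0) (p.2 i 0)) (isovec (p.1 j 0) (p.2 j 0)).
Proof.
wlog ij : i j / (i < j)%N => [hw nij|_ ijK].
  case: (ltngtP i j) => [|lt_ji ijK|/val_inj ij]; first by move=> *; exact: hw.
    rewrite sqdistC -hw 1?eq_sym // /Lval; last by rewrite finset.setUC.
    by rewrite finset.setUC.
  by rewrite ij eqxx in nij.
have tK : [tuple i; j] \in edges K.
  rewrite inE /= ij /=; suff -> : [set x in [:: i; j]]%SET = [set i; j]%SET by [].
  by apply/setP => x; rewrite !inE.
have := LvalE (G2 K p) (enum_rank_in tK [tuple i; j]).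
by rewrite mxE enum_rankK_in.
Qed.

(** The zero diagonal of the determinant agrees with the Gram matrix because
    the vectors are isotropic. *)
Lemma G3_G2 p : simplicial_complex K -> G3 (G2 K p) = 0.
Proof.
move=> [_ Ksub _]; apply/colP => s; rewrite !mxE.
pose v (a : 'I_4) := tnth (enum_val s) a.
pose u a := isovec (p.1 (v a) 0) (p.2 (v a) 0).
rewrite -[RHS](det_dot_eq0 (-2) u); congr (\det _); apply/matrixP => a b.
rewrite !mxE /u; have [->|ab] := eqVneq a b; first by rewrite dot_isovec mulr0.
have := enum_valP s; rewrite inE => /andP[sv vK].
rewrite -sqdist_isovecN2dot Lval_G2 //.
  rewrite (tnth_nth (v a)) (tnth_nth (v a) _ b) nth_uniq ?size_tuple //.
  apply: (sorted_uniq (leT := fun i j : 'I_n => (i < j)%N)) sv.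
    by move=> x y z; exact: ltn_trans.
  by move=> x; rewrite ltnn.
apply: Ksub vK _ _; last by apply/card_gt0P; exists (v a); rewrite !inE eqxx.
by apply/fintype.subsetP => x; rewrite !inE => /orP[] /eqP ->; exact: mem_tnth.
Qed.

Lemma g3_g2_eq0 kappa zeta p : simplicial_complex K ->
  g3 K kappa zeta (g2 K kappa zeta p) = 0.
Proof.
move=> sK; rewrite /g3 /g2 /= -G2_initial.
have := diff_comp (differentiable_G2 (kappa, zeta))
                  (differentiable_G3 (G2 K (kappa, zeta))).
have -> : @G3 C n K \o G2 K = cst 0 by apply/funext => q; exact: G3_G2.
by rewrite diff_cst => /(congr1 (@^~ p)).
Qed.

End ChainComplex.

Theorem theorem4 (R : realType) (M : topologicalType)
    (Mmanifold : closed_manifold3 R M)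
    (n : nat) (K : {set {set 'I_n}}) (phi : M -> 'rV[R]_n)
    (Mtriangulated : triangulation K phi)
    (or : {set 'I_n} -> int) (Moriented : orientation K or)
    (kappa zeta : 'cV[R[i]]_n)
    (kappa_neq0 : forall i, kappa i 0 != 0)
    (zeta_neq : forall i j, i != j -> [set i; j]%SET \in K ->
                zeta i 0 != zeta j 0) :
  differentials_exist K kappa zeta /\
  chain_complex (g1 kappa zeta) (g2 K kappa zeta) (g3 K kappa zeta).
Proof.
have [sK _] := Mtriangulated; split.
  by split; [exact: differentiable_G1|exact: differentiable_G2
            |exact: differentiable_G3].
by split=> v; [exact: g3_g2_eq0|exact: g2_g1_eq0].
Qed.
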